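(* Let $Z(x,\hbar)=\exp\Big[\sum_{g\ge0}\sum_{n\ge1}\frac{\hbar^{2g-2+n}}{n!}F_{g,n}(x,x,\ldots,x)\Big]$, a formal series in $x$ and $\hbar$ (more precisely in $\mathbb{Q}[[x\hbar^{-1},\hbar]]$). Then, with $\widehat x=x$ and $\widehat y=-\hbar\frac{\partial}{\partial x}$, \[ [\widehat x\,\widehat y^{\,2}+\widehat y+1]\,Z(x,\hbar)=0,\quad\text{i.e.}\quad \Big[x\hbar^2\frac{\partial^2}{\partial x^2}-\hbar\frac{\partial}{\partial x}+1\Big]Z(x,\hbar)=0. \]
   Context: Monotone Hurwitz numbers: for $g\ge0$, $n\ge1$ and positive integers $\mu_1,\ldots,\mu_n$ with $|\boldsymbol\mu|=\mu_1+\cdots+\mu_n$, let $m=2g-2+n+|\boldsymbol\mu|$. The monotone Hurwitz number $\vec H_{g,n}(\mu_1,\ldots,\mu_n)$ is $\frac{1}{|\boldsymbol\mu|!}$ times the number of $m$-tuples $(\sigma_1,\ldots,\sigma_m)$ of transpositions in $S_{|\boldsymbol\mu|}$, together with a labelling of the cycles of $\sigma_1\circ\cdots\circ\sigma_m$ by $1,\ldots,n$, such that cycle $i$ has length $\mu_i$; the $\sigma_j$ generate a transitive subgroup; and writing $\sigma_j=(a_j\,b_j)$ with $a_j<b_j$, $b_1\le\cdots\le b_m$ (zero if $m<0$). The free energy is $F_{g,n}(x_1,\ldots,x_n)=\sum_{\mu_i\ge1}\vec H_{g,n}(\boldsymbol\mu)x_1^{\mu_1}\cdots x_n^{\mu_n}$;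 $F_{g,n}(x,\ldots,x)$ denotes setting all variables equal to $x$. *)

(* Defs.v *)
From HB Require Import structures.
From mathcomp Require Import all_boot all_order all_algebra all_fingroup.
Set Implicit Arguments.
Unset Strict Implicit.
Unset Printing Implicit Defensive.
Import Order.TTheory GRing.Theory Num.Theory.

Local Open Scope ring_scope.

Definition transps (N : nat) (t : seq ('I_N * 'I_N)) : seq {perm 'I_N} :=
  [seq tperm q.1 q.2 | q <- t].

(* sigma_1 o sigma_2 o ... o sigma_m as a function composition
   (mathcomp: (s * t) x = t (s x), hence the order below). *)
Definition compose_all (N : nat) (s : seq {perm 'I_N}) : {perm 'I_N} :=
  foldr (fun a acc => (acc * a)%g) 1%g s.

Definition monotone_valid (N m n : nat) (mu : 'I_n -> nat)
    (p : (m.-tuple ('I_N * 'I_N)) * {ffun 'I_n -> {set 'I_N}}) : bool :=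
  let t := tval p.1 in
  let f := p.2 in
  let sig := transps t in
  let P := compose_all sig in
  [&& all (fun q : 'I_N * 'I_N => (q.1 < q.2)%N) t,
      sorted leq [seq nat_of_ord q.2 | q <- t],
      [transitive <<[set x in sig]>>%g, on [set: 'I_N] | 'P],
      injectiveb f,
      [set f i | i : 'I_n] == porbits P &
      [forall i, #|f i| == mu i] ].

Definition monotone_count (N m n : nat) (mu : 'I_n -> nat) : nat :=
  #|[set p | @monotone_valid N m n mu p]|.

Definition monotoneH (g n : nat) (mu : 'I_n -> nat) : rat :=
  let N := (\sum_(i < n) mu i)%N in
  if (2 * g + n + N < 2)%N then 0
  else (monotone_count N (2 * g + n + N - 2) mu)%:R / (N`!)%:R.

(* Coefficient of x^d in F_{g,n}(x,...,x): sum of H_{g,n}(mu) over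
   mu in Z_{>0}^n with |mu| = d. *)
Definition Fdiag_coef (g n d : nat) : rat :=
  \sum_(mu : {ffun 'I_n -> 'I_d.+1} |
          [forall i, (0 < mu i)%N] && ((\sum_(i < n) (mu i : nat))%N == d))
     monotoneH g (fun i => nat_of_ord (mu i)).

(* Formal series in x and hbar: s d k = coefficient of x^d hbar^k (k : int). *)
(* The ring Q[[x hbar^{-1}, hbar]] consists of those with s d k = 0          *)
(* whenever d + k < 0 (x^d hbar^k = (x/hbar)^d hbar^(d+k)).                  *)

Definition series := nat -> int -> rat.

Definition in_Qxh (s : series) : Prop :=
  forall (d : nat) (k : int), k + d%:Z < 0 -> s d k = 0.

Definition oneS : series := fun d k => if (d == 0%N) && (k == 0) then 1 else 0.

Definition addS (s t : series) : series := fun d k => s d k + t d k.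
Definition subS (s t : series) : series := fun d k => s d k - t d k.

(* Product in Q[[x hbar^{-1}, hbar]]: x-degrees d1 + d2 = d, hbar-exponents
   k1 + k2 = k with k1 >= -d1 and k2 >= -(d - d1); writing k1 = i - d1 the
   range is 0 <= i <= k + d. *)
Definition mulS (s t : series) : series := fun d k =>
  if k + d%:Z < 0 then 0 else
  \sum_(d1 < d.+1) \sum_(i < (absz (k + d%:Z)).+1)
     s d1 (i%:Z - d1%:Z) * t (d - d1)%N (k - (i%:Z - d1%:Z)).

Fixpoint powS (s : series) (j : nat) : series :=
  match j with
  | 0 => oneS
  | j'.+1 => mulS s (powS s j')
  end.

(* exp(L) = sum_j L^j / j!, for L in Q[[x hbar^{-1}, hbar]] with zero
   constant term: then L^j has total degree >= j in (x/hbar, hbar), and the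
   total degree of x^d hbar^k is d + (d + k) = 2d + k, so only j <= 2d + k
   contribute to the coefficient of x^d hbar^k. *)
Definition expS (L : series) : series := fun d k =>
  \sum_(j < (absz (2 * d%:Z + k)).+1) powS L j d k / (j`!)%:R.

Definition mulxS (s : series) : series := fun d k =>
  match d with 0 => 0 | d'.+1 => s d' k end.
Definition mulhS (s : series) : series := fun d k => s d (k - 1).
Definition dxS (s : series) : series := fun d k => (d.+1)%:R * s d.+1 k.

(* The exponent  sum_{g>=0} sum_{n>=1} hbar^{2g-2+n}/n! F_{g,n}(x,...,x):
   coefficient of x^d hbar^k; only 2g - 2 + n = k contributes, which forces
   n, g <= k + 2. *)
Definition logZ : series := fun d k =>
  \sum_(n < (absz (k + 2)).+1) \sum_(g < (absz (k + 2)).+1)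
    if (0 < n)%N && ((2 * g + n)%:Z - 2 == k)
    then Fdiag_coef g n d / (n`!)%:R else 0.

Definition Zser : series := expS logZ.

Definition quantum_curve_op (s : series) : series :=
  addS (subS (mulxS (mulhS (mulhS (dxS (dxS s))))) (mulhS (dxS s))) s.

(* Main.v *)
(* Let D(N,m) be the number of all monotone words of m transpositions in S_N and
   C(N,m) the number of those that generate a transitive subgroup.  A monotone
   word is determined by its restrictions to the orbits, since the larger letters
   fix the interleaving.  Marking a point and splitting off its orbit gives
     N D(N,m) / N! = sum_(j,a) j C(j,a) / j! * D(N-j,m-a) / (N-j)!,
   which is x d/dx of the exponential formula.  Forgetting the cycle labels turns
   the exponent of Z into sum C(d,m) / d! x^d hbar^(m-d): parity and the inequality
   n + d <= m + 2 for transitive words make the genus a natural number.  Hence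
   Z = sum D(d,m) / d! x^d hbar^(m-d), and the quantum curve equation becomes
     D(d+1,m+1) = d D(d+1,m) + D(d,m+1),
   obtained by asking whether the last transposition moves the largest point. *)
Require Import Defs.
From HB Require Import structures.
From mathcomp Require Import all_boot all_order all_algebra all_fingroup.
From mathcomp Require Import zify ring.
Set Implicit Arguments.
Unset Strict Implicit.
Unset Printing Implicit Defensive.
Import Order.TTheory GRing.Theory Num.Theory.

(** * Counting words *)

(** The predicate is on sequences, so that restriction, sorting and concatenation may change the
    length without casts between tuple types. *)
Definition count_words (T : finType) (P : pred (seq T)) (m : nat) : nat :=
  #|[set t : m.-tuple T | P t]|.

Definition words (T : finType) (m : nat) : seq (seq T) :=
  map (@tval m T) (enum {: m.-tuple T}).

Lemma words_uniq (T : finType) m : uniq (words T m).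
Proof. by rewrite map_inj_uniq ?enum_uniq //; apply: val_inj. Qed.

Lemma mem_words (T : finType) m (t : seq T) : (t \in words T m) = (size t == m).
Proof.
apply/mapP/eqP => [[u _ ->]|szt]; first exact: size_tuple.
by exists (Tuple (introT eqP szt)); rewrite ?mem_enum.
Qed.

Lemma count_wordsE (T : finType) (P : pred (seq T)) m :
  count_words P m = count P (words T m).
Proof.
rewrite count_map -size_filter /count_words cardE.
rewrite -[enum _](filter_predT) [in RHS]enumT /enum_mem.
by congr (size _); rewrite -filter_predI; apply: eq_filter => t; rewrite /= inE.
Qed.

Lemma eq_count_words (T : finType) (P Q : pred (seq T)) m :
  (forall t, size t = m -> P t = Q t) -> count_words P m = count_words Q m.
Proof.
by move=> PQ; apply: eq_card => t; rewrite !inE PQ ?size_tuple.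
Qed.

Lemma count_words_map (T1 T2 : finType) (f : T1 -> T2) (P : pred (seq T2))
    (Q : pred (seq T1)) m :
  injective f -> (forall u, P (map f u) = Q u) ->
  (forall t, P t -> {subset t <= codom f}) ->
  count_words P m = count_words Q m.
Proof.
move=> f_inj PQ Pf.
rewrite !count_wordsE -!size_filter -(size_map (map f)); apply: perm_size.
have fm_inj := inj_map f_inj.
apply: uniq_perm; rewrite ?map_inj_uniq ?filter_uniq ?words_uniq // => t.
rewrite mem_filter mem_words; apply/andP/mapP => [[Pt /eqP szt]|[u]].
  have [u def_t] : exists u, t = map f u.
    move/Pf: Pt; elim: t {szt} => [|q t IHt] sub; first by exists [::].
    have /codomP[q' ->] := sub q (mem_head q t).
    case: IHt => [x xt|u ->]; first by apply: sub; rewrite inE xt orbT.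
    by exists (q' :: u).
  exists u => //; rewrite mem_filter mem_words -PQ -def_t Pt /=.
  by rewrite -szt def_t size_map.
by rewrite mem_filter mem_words => /andP[Qu /eqP szu] ->; rewrite PQ size_map szu.
Qed.

(** Splitting and [join] are mutually inverse between the words satisfying [P] and the pairs of a
    [P1] word and a [P2] word; grouping by the length of the first component gives the
    convolution. *)
Lemma count_words_conv (T T1 T2 : finType) (P : pred (seq T))
    (P1 : pred (seq T1)) (P2 : pred (seq T2)) split1 split2 join m :
  (forall t, P t -> [/\ P1 (split1 t), P2 (split2 t),
     size (split1 t) + size (split2 t) = size t
     & join (split1 t) (split2 t) = t]) ->
  (forall u v, P1 u -> P2 v ->
     [/\ P (join u v), split1 (join u v) = u & split2 (join u v) = v]) ->
  count_words P m =
    \sum_(a < m.+1) count_words P1 a * count_words P2 (m - a).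
Proof.
move=> PE joinE.
rewrite count_wordsE -sum1_count.
(* The two lengths add up to [m], so [inord] keeps the true value. *)
rewrite (partition_big (fun t => inord (size (split1 t)) : 'I_m.+1) xpredT) //=.
apply: eq_bigr => a _.
rewrite !count_wordsE sum1_count -!size_filter -[RHS](size_allpairs join).
apply: perm_size; apply: uniq_perm.
- by rewrite !filter_uniq ?words_uniq.
- apply: allpairs_uniq; rewrite ?filter_uniq ?words_uniq //.
  move=> [u v] [u' v'] /allpairsP[[x y] /= [+ + [-> ->]]].
  move=> + + /allpairsP[[x' y'] /= [+ + [-> ->]]].
  rewrite !mem_filter => /andP[P1x _] /andP[P2y _] /andP[P1x' _] /andP[P2y' _].
  have [_ xE yE] := joinE x y P1x P2y.
  have [_ x'E y'E] := joinE x' y' P1x' P2y' => exy.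
  by congr (_, _); [rewrite -xE exy x'E | rewrite -yE exy y'E].
move=> t; rewrite !mem_filter mem_words.
apply/idP/allpairsP => [/andP[/andP[Pt /eqP <-] /eqP szt]|[[u v] /= []]].
  have [P1t P2t szE tE] := PE t Pt.
  exists (split1 t, split2 t); split=> //=; rewrite mem_filter mem_words ?P1t ?P2t //=.
    by rewrite inordK //; lia.
  by rewrite inordK //; lia.
rewrite !mem_filter !mem_words => /andP[P1u /eqP szu] /andP[P2v /eqP szv] ->.
have [Puv uE vE] := joinE u v P1u P2v; have [_ _ + _] := PE _ Puv.
rewrite uE vE Puv /= => <-; have := ltn_ord a => lta.
by apply/andP; split; [apply/eqP/val_inj; rewrite /= inordK | ]; lia.
Qed.

(** * Monotone words and their blocks *)

Section Words.
Variable N : nat.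
Implicit Types (t u v : seq ('I_N * 'I_N)) (A B S : {set 'I_N}).

Definition monotone_word t :=
  all (fun q : 'I_N * 'I_N => q.1 < q.2) t && sorted leq [seq nat_of_ord q.2 | q <- t].

Definition word_on S t := all (fun q : 'I_N * 'I_N => (q.1 \in S) && (q.2 \in S)) t.

Definition closed_under t A := all (fun q : 'I_N * 'I_N => (q.1 \in A) == (q.2 \in A)) t.

(** Connectedness of the graph with the letters as edges, stated through cuts. *)
Definition connected_on S t :=
  [forall A : {set 'I_N}, (A \subset S) && closed_under t A ==> (A == set0) || (A == S)].

(** For closed [S] both entries of a letter lie on the same side, so one test decides; the
    restrictions to [S] and [~: S] always share out the letters. *)
Definition restrict_word S t := [seq q <- t | q.2 \in S].

Definition bigger_leq : rel ('I_N * 'I_N) := relpre (fun q => nat_of_ord q.2) leq.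

Lemma bigger_leq_total : total bigger_leq.
Proof. by move=> q r; apply: leq_total. Qed.

Lemma bigger_leq_trans : transitive bigger_leq.
Proof. by move=> q r s; apply: leq_trans. Qed.

Lemma monotone_wordE t :
  monotone_word t = all (fun q : 'I_N * 'I_N => q.1 < q.2) t && sorted bigger_leq t.
Proof. by rewrite /monotone_word sorted_map. Qed.

(** Both heads attain the least second entry, so they lie on the same side of [S] and head the same
    restriction; hence they coincide, and induction applies to the tails. *)
Lemma sorted_restrict_inj S t u :
  sorted bigger_leq t -> sorted bigger_leq u ->
  restrict_word S t = restrict_word S u ->
  restrict_word (~: S) t = restrict_word (~: S) u -> t = u.
Proof.
have mem_eq w w' : restrict_word S w = restrict_word S w' ->
    restrict_word (~: S) w = restrict_word (~: S) w' -> {subset w <= w'}.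
  move=> eS eC q qw; have [qS|qS] := boolP (q.2 \in S).
    have: q \in restrict_word S w by rewrite mem_filter qS.
    by rewrite eS mem_filter => /andP[].
  have: q \in restrict_word (~: S) w by rewrite mem_filter inE qS.
  by rewrite eC mem_filter => /andP[].
elim: t u => [|q t IHt] [|r u] // st su eS eC.
- by have := mem_eq _ _ (esym eS) (esym eC) r (mem_head r u).
- by have := mem_eq _ _ eS eC q (mem_head q t).
have head_min (x y : 'I_N * 'I_N) w : y \in x :: w -> path bigger_leq x w -> bigger_leq x y.
  rewrite inE => /predU1P[-> _|yw]; first exact: leqnn.
  by rewrite (path_sortedE bigger_leq_trans) => /andP[/allP/(_ y yw)].
have qr : nat_of_ord q.2 = r.2.
  apply/eqP; rewrite eqn_leq; apply/andP; split.
    by apply: (head_min q r t) => //; apply: mem_eq (esym eS) (esym eC) _ (mem_head _ _).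
  by apply: (head_min r q u) => //; apply: mem_eq eS eC _ (mem_head _ _).
have qr2 : q.2 = r.2 by apply: val_inj.
have [qS|qS] := boolP (q.2 \in S).
  move: eS eC; rewrite /= !inE -!qr2 qS /= => -[-> eS] eC.
  by rewrite (IHt u) ?(path_sorted st) ?(path_sorted su).
move: eS eC; rewrite /= !inE -!qr2 (negbTE qS) /= => eS [-> eC].
by rewrite (IHt u) ?(path_sorted st) ?(path_sorted su).
Qed.

Lemma restrict_word_on S t : word_on S t -> restrict_word S t = t.
Proof. by move=> /allP St; apply/all_filterP/allP => q /St/andP[]. Qed.

Lemma restrict_word_onC S t : word_on (~: S) t -> restrict_word S t = [::].
Proof.
move=> /allP St; apply/eqP; rewrite -(negbK (_ == _)) -has_filter.
by apply/hasPn => q /St/andP[_]; rewrite inE.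
Qed.

Lemma closed_underC t S : closed_under t (~: S) = closed_under t S.
Proof. by apply: eq_all => q; rewrite !inE (inj_eq negb_inj). Qed.

Lemma word_on_restrict t S : closed_under t S -> word_on S (restrict_word S t).
Proof.
move=> /allP St; apply/allP => q; rewrite mem_filter => /andP[qS /St/eqP->].
by rewrite qS.
Qed.

Lemma monotone_restrict t S : monotone_word t -> monotone_word (restrict_word S t).
Proof.
rewrite !monotone_wordE => /andP[lt_t st]; apply/andP; split.
  by apply/allP => q; rewrite mem_filter => /andP[_]; apply/allP: q.
exact: sorted_filter bigger_leq_trans _ _ st.
Qed.

(** Stable sorting commutes with filtering, and each filter leaves one sorted factor of [u ++ v]. *)
Lemma restrict_merge S u v : word_on S u -> word_on (~: S) v ->
  sorted bigger_leq u -> sorted bigger_leq v ->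
  restrict_word S (sort bigger_leq (u ++ v)) = u /\
  restrict_word (~: S) (sort bigger_leq (u ++ v)) = v.
Proof.
move=> Su Sv su sv.
rewrite /restrict_word !(filter_sort bigger_leq_total bigger_leq_trans) !filter_cat.
have uC : word_on (~: ~: S) u by rewrite setCK.
rewrite -!/(restrict_word _ _) (restrict_word_on Su) (restrict_word_on Sv).
rewrite (restrict_word_onC Sv) (restrict_word_onC uC).
by rewrite cats0 /= !(sorted_sort bigger_leq_trans).
Qed.

(* Since [bigger_leq] only looks at the larger letter, the stable sort is the
   only way to interleave two monotone words with disjoint supports. *)
Lemma count_words_shuffle (Q : pred (seq ('I_N * 'I_N))) S m :
  count_words (fun t => [&& monotone_word t, closed_under t S
                           & Q (restrict_word S t)]) m =
  \sum_(a < m.+1)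
     count_words (fun u => [&& monotone_word u, word_on S u & Q u]) a *
     count_words (fun v => monotone_word v && word_on (~: S) v) (m - a).
Proof.
apply: (@count_words_conv _ _ _ _ _ _ (restrict_word S) (restrict_word (~: S))
          (fun u v => sort bigger_leq (u ++ v))).
  move=> t /and3P[mt St Qt].
  have sC : [seq q <- t | q.2 \in ~: S] = [seq q <- t | predC (fun q => q.2 \in S) q].
    by apply: eq_filter => q; rewrite /= inE.
  have muv A := monotone_restrict A mt.
  have suv A : sorted bigger_leq (restrict_word A t).
    by have := muv A; rewrite monotone_wordE => /andP[].
  have Su := word_on_restrict St.
  have Sv : word_on (~: S) (restrict_word (~: S) t).
    by rewrite word_on_restrict ?closed_underC.
  have [uE vE] := restrict_merge Su Sv (suv _) (suv _).
  rewrite !muv Su Sv Qt /=; split=> //.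
    by rewrite /restrict_word sC !size_filter count_predC.
  have := mt; rewrite monotone_wordE => /andP[_ st].
  by apply: (@sorted_restrict_inj S) => //; apply: sort_sorted bigger_leq_total _.
move=> u v /and3P[mu Su Qu] /andP[mv Sv].
have := mu; rewrite monotone_wordE => /andP[lu su].
have := mv; rewrite monotone_wordE => /andP[lv sv].
have [uE vE] := restrict_merge Su Sv su sv.
split=> //; rewrite uE Qu andbT monotone_wordE all_sort all_cat lu lv /=.
rewrite (sort_sorted bigger_leq_total) /= /closed_under all_sort all_cat.
apply/andP; split; apply/allP => q.
  by move/(allP Su)/andP => [-> ->].
by move/(allP Sv); rewrite !inE => /andP[/negbTE-> /negbTE->].
Qed.

(** The orbit of [x] under the group generated by the transpositions, as the least closed set
    through [x]. *)
Definition block t x := \bigcap_(A : {set 'I_N} | closed_under t A && (x \in A)) A.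

Lemma mem_block t x : x \in block t x.
Proof. by apply/bigcapP => A /andP[]. Qed.

Lemma block_min t x A : closed_under t A -> x \in A -> block t x \subset A.
Proof. by move=> tA xA; apply: bigcap_inf; rewrite tA. Qed.

Lemma closed_block t x : closed_under t (block t x).
Proof.
apply/allP => q qt; apply/eqP; apply/bigcapP/bigcapP => qA A tA;
  by have := qA A tA; have /andP[/allP/(_ q qt)/eqP-> _] := tA.
Qed.

Lemma closedD t A B : closed_under t A -> closed_under t B -> closed_under t (A :\: B).
Proof.
move=> /allP tA /allP tB; apply/allP => q qt.
by rewrite !inE (eqP (tA q qt)) (eqP (tB q qt)).
Qed.

Lemma closed_restrict t B A : closed_under t B -> A \subset B ->
  closed_under (restrict_word B t) A = closed_under t A.
Proof.
move=> /allP tB AB; rewrite /closed_under all_filter; apply: eq_in_all => q qt /=.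
case: (boolP (q.2 \in B)) => //= q2B; have q1B := q2B; rewrite -(eqP (tB q qt)) in q1B.
by rewrite !(contraNF (subsetP AB _)).
Qed.

(** A closed part of the block either contains [x], and is everything by minimality, or has a closed
    complement in the block through [x], and is empty. The left side has the shape required by
    [count_words_shuffle]. *)
Lemma block_eqP t x B :
  [&& x \in B, closed_under t B & connected_on B (restrict_word B t)] = (B == block t x).
Proof.
apply/and3P/eqP => [[xB tB /forallP/(_ (block t x))] | ->].
  rewrite block_min //= closed_restrict ?block_min ?closed_block //=.
  case/orP=> /eqP bE //; by have := mem_block t x; rewrite bE inE.
split; rewrite ?mem_block ?closed_block //.
apply/forallP => A; apply/implyP => /andP[sAb].
rewrite closed_restrict ?closed_block // => tA.
rewrite [_ || _]orbC eqEsubset sAb /=.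
have [xA|xA] := boolP (x \in A); first by rewrite block_min.
have sub : block t x \subset block t x :\: A.
  by rewrite block_min ?closedD ?closed_block // inE xA mem_block.
apply/orP; right; rewrite -subset0; apply/subsetP => y yA.
by have := subsetP sub y (subsetP sAb y yA); rewrite inE yA.
Qed.

End Words.

(** * Relabelling words along increasing maps *)

Definition relabel_letter (j N : nat) (f : 'I_j -> 'I_N) (q : 'I_j * 'I_j) :=
  (f q.1, f q.2).

Section Relabel.
Variables (j N : nat) (f : 'I_j -> 'I_N).
Hypothesis f_mono : {mono f : x y / (x < y)%N}.

Local Notation fq := (relabel_letter f).
Local Notation S := [set f x | x : 'I_j].

Lemma relabel_inj : injective f.
Proof.
move=> x y fxy; apply: val_inj; have := f_mono x y; have := f_mono y x.
by rewrite fxy ltnn; case: ltngtP.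
Qed.

Lemma monotone_relabel u : monotone_word (map fq u) = monotone_word u.
Proof.
rewrite /monotone_word all_map -map_comp !sorted_map; congr (_ && _).
  by apply: eq_all => q; rewrite /= f_mono.
by apply: eq_sorted => q r /=; rewrite leqNgt f_mono -leqNgt.
Qed.

Lemma word_on_relabel u : word_on S (map fq u).
Proof. by rewrite /word_on all_map; apply/allP => q _; rewrite /= !imset_f. Qed.

Lemma closed_relabel u (A : {set 'I_N}) :
  closed_under (map fq u) A = closed_under u (f @^-1: A).
Proof. by rewrite /closed_under all_map; apply: eq_all => q; rewrite /= !inE. Qed.

(** Image and preimage under [f] match the subsets of [S] with those of ['I_j] and respect
    closedness. *)
Lemma connected_relabel u : connected_on S (map fq u) = connected_on setT u.
Proof.
have preK (A : {set 'I_N}) : A \subset S -> f @: (f @^-1: A) = A.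
  move=> sAS; apply/setP => y; apply/imsetP/idP => [[x + ->]|yA]; first by rewrite inE.
  have /imsetP[x _ yx] := subsetP sAS y yA.
  by exists x; rewrite ?inE -?yx.
have imK (A : {set 'I_j}) : f @^-1: (f @: A) = A.
  by apply/setP => x; rewrite inE (mem_imset _ _ relabel_inj).
apply/forallP/forallP => conn A; apply/implyP => /andP[sAS].
  move=> uA; have := conn (f @: A).
  rewrite closed_relabel imK uA imsetS ?subset_predT //= => /orP[]/eqP eA.
    by rewrite -[A]imK eA preimset0 eqxx.
  apply/orP; right; rewrite -[A]imK eA; apply/eqP/setP => x.
  by rewrite !inE imset_f.
rewrite closed_relabel => uA; have := conn (f @^-1: A).
rewrite subsetT uA /= => /orP[]/eqP eA; rewrite -(preK A sAS) eA.
  by rewrite imset0 eqxx.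
apply/orP; right; apply/eqP/setP => y.
by apply/imsetP/imsetP => -[x _ ->]; exists x.
Qed.

Lemma count_words_relabel (P : pred (seq ('I_N * 'I_N))) (Q : pred (seq ('I_j * 'I_j))) m :
  (forall u, P (map fq u) = Q u) ->
  count_words (fun t => [&& monotone_word t, word_on S t & P t]) m =
  count_words (fun u => monotone_word u && Q u) m.
Proof.
move=> PQ; apply: (@count_words_map _ _ fq).
- by move=> [a b] [c d] [/relabel_inj-> /relabel_inj->].
- by move=> u; rewrite monotone_relabel word_on_relabel PQ.
move=> t /and3P[_ /allP tS _] q /tS /andP[/imsetP[x _ q1] /imsetP[y _ q2]].
by apply/codomP; exists (x, y); rewrite /relabel_letter -q1 -q2; case: q {q1 q2}.
Qed.

End Relabel.

Definition mono_count N m := count_words (@monotone_word N) m.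

(** For N > 0 connected means transitive. At N = 0 the empty word counts as connected; the factor
    [j] in the block recursion cancels that value. *)
Definition conn_count N m :=
  count_words (fun t : seq ('I_N * 'I_N) => monotone_word t && connected_on setT t) m.

(** [enum S] is increasing, so [enum_val] is the order isomorphism that standardises words on
    [S]. *)
Lemma enum_val_mono N (S : {set 'I_N}) :
  {mono (fun i : 'I_#|S| => enum_val i) : x y / (x < y)%N}.
Proof.
have homo (x y : 'I_#|S|) : (x < y)%N -> (enum_val x < enum_val y)%N.
  have x0 := enum_val x; rewrite !(enum_val_nth x0) => xy.
  pose ltN : rel 'I_N := relpre val ltn.
  have ltN_trans : transitive ltN by move=> ? ? ?; apply: ltn_trans.
  have sS : sorted ltN (enum S).
    rewrite /enum_mem -enumT; apply: sorted_filter => //.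
    by rewrite -sorted_map val_enum_ord iota_ltn_sorted.
  by apply: (sorted_ltn_nth ltN_trans x0 sS); rewrite ?inE -?cardE.
move=> x y; have [xy|yx|/val_inj->] := ltngtP x y; last by rewrite ltnn.
  exact: homo.
by apply/negbTE; rewrite -leqNgt ltnW // homo.
Qed.

Lemma imset_enum_val (T : finType) (S : {set T}) :
  [set enum_val i | i : 'I_#|S|] = S.
Proof.
apply/setP => x; apply/imsetP/idP => [[i _ ->]|xS]; first exact: enum_valP.
by exists (enum_rank_in xS x); rewrite ?enum_rankK_in.
Qed.

(** * Recursions for monotone words *)

Lemma count_mono_on N (S : {set 'I_N}) m :
  count_words (fun t => monotone_word t && word_on S t) m = mono_count #|S| m.
Proof.
rewrite -[in LHS](imset_enum_val S).
transitivity (count_words (fun u : seq ('I_#|S| * 'I_#|S|) => monotone_word u && true) m).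
  rewrite -(@count_words_relabel _ _ _ (@enum_val_mono _ S) xpredT xpredT) //.
  by apply: eq_count_words => t _; rewrite andbT.
by apply: eq_count_words => t _; rewrite andbT.
Qed.

Lemma count_conn_on N (S : {set 'I_N}) m :
  count_words (fun t => [&& monotone_word t, word_on S t & connected_on S t]) m =
  conn_count #|S| m.
Proof.
rewrite -[in LHS](imset_enum_val S).
apply: (count_words_relabel (@enum_val_mono _ S)) => u.
exact: connected_relabel (@enum_val_mono _ S) u.
Qed.

(* Words with a marked point [x], grouped by the block [B] of [x]. *)
Lemma mono_count_blocks N m :
  N * mono_count N m =
  \sum_(j < N.+1) 'C(N, j) *
     (j * \sum_(a < m.+1) conn_count j a * mono_count (N - j) (m - a)).
Proof.
(* The number of words in which the block of the marked point is a prescribed set of size [j]. *)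
pose F j := \sum_(a < m.+1) conn_count j a * mono_count (N - j) (m - a).
have block_count (x : 'I_N) (B : {set 'I_N}) :
    #|[set t : m.-tuple ('I_N * 'I_N) | monotone_word t && (B == block t x)]| =
    if x \in B then F #|B| else 0.
  case: ifP => xB.
    rewrite -[LHS]/(count_words (fun t => monotone_word t && (B == block t x)) m).
    pose Q t := connected_on B t.
    transitivity (count_words (fun t => [&& monotone_word t, closed_under t B
                                          & Q (restrict_word B t)]) m).
      by apply: eq_count_words => t _; rewrite -block_eqP xB.
    rewrite count_words_shuffle; apply: eq_bigr => a _.
    by rewrite count_conn_on count_mono_on (cardsCs (~: B)) setCK card_ord.
  by apply: eq_card0 => t; rewrite !inE -block_eqP xB andbF.
have -> : N * mono_count N m =
    \sum_(x : 'I_N) \sum_(B : {set 'I_N}) (if x \in B then F #|B| else 0).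
  rewrite -[X in X * _](card_ord N) -sum_nat_const; apply: eq_bigr => x _.
  rewrite /mono_count /count_words -sum1_card.
  rewrite (partition_big (fun t : m.-tuple _ => block t x) xpredT) //=.
  apply: eq_bigr => B _; rewrite -block_count -sum1_card.
  by apply: eq_bigl => t; rewrite !inE eq_sym.
(* Each [B] now occurs once for each of its points; the sets [B] are then grouped by size. *)
rewrite exchange_big /=.
rewrite (partition_big (fun B : {set 'I_N} => inord #|B| : 'I_N.+1) xpredT) //=.
have card_lt (B : {set 'I_N}) : #|B| < N.+1 by rewrite ltnS -[leqRHS]card_ord max_card.
apply: eq_bigr => j _.
have -> : 'C(N, j) = #|[set B : {set 'I_N} | #|B| == j]|.
  by rewrite card_draws card_ord.
rewrite -sum_nat_const.
apply: eq_big => [B|B /eqP <-]; first by rewrite inE -val_eqE /= inordK.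
by rewrite inordK // -big_mkcond sum_nat_const.
Qed.

Lemma mono_count0 N : mono_count N 0 = 1.
Proof.
rewrite /mono_count /count_words -[RHS](cards1 ([tuple] : 0.-tuple ('I_N * 'I_N))).
by apply: eq_card => t; rewrite !inE tuple0.
Qed.

Lemma mono_count_ord0 m : mono_count 0 m.+1 = 0.
Proof. by apply: eq_card0 => t; case: (thead t) => -[]. Qed.

Lemma monotone_word_rcons N (t : seq ('I_N * 'I_N)) q :
  monotone_word (rcons t q) =
  [&& q.1 < q.2, all (fun r : 'I_N * 'I_N => r.2 <= q.2) t & monotone_word t].
Proof.
rewrite /monotone_word all_rcons map_rcons !(sorted_pairwise leq_trans).
by rewrite pairwise_rcons all_map -!andbA; do !bool_congr.
Qed.

(** If the last letter moves the top point, deleting it leaves an arbitrary monotone word and [d]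
    choices of partner. Otherwise monotonicity keeps every letter below the top point. *)
Lemma mono_countSS d m :
  mono_count d.+1 m.+1 = d * mono_count d.+1 m + mono_count d m.+1.
Proof.
pose M t := last ord0 [seq q.2 | q : 'I_d.+1 * 'I_d.+1 <- t] == ord_max.
have M_rcons t q : M (rcons t q) = (q.2 == ord_max) by rewrite /M map_rcons last_rcons.
have -> : mono_count d.+1 m.+1 =
    #|[set t : m.+1.-tuple _ | monotone_word t && M t]| +
    #|[set t : m.+1.-tuple _ | monotone_word t && ~~ M t]|.
  rewrite /mono_count /count_words -(cardsID [set t : m.+1.-tuple _ | M t]).
  by congr (_ + _); apply: eq_card => t; rewrite !inE // andbC.
have dE (x : 'I_d.+1) : x \in [set widen_ord (leqnSn d) y | y : 'I_d] = (x < d).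
  apply/imsetP/idP => [[y _ ->]|xd]; first exact: (ltn_ord y).
  by exists (Ordinal xd) => //; apply: val_inj.
congr (_ + _).
  pose R := [set p : 'I_d * m.-tuple ('I_d.+1 * 'I_d.+1) | monotone_word p.2].
  have -> : d * mono_count d.+1 m = #|R|.
    rewrite -[X in X * _](card_ord d) -cardsT -cardsX; apply: eq_card => p; by rewrite !inE.
  pose h (p : 'I_d * m.-tuple ('I_d.+1 * 'I_d.+1)) : m.+1.-tuple _ :=
    [tuple of rcons p.2 (widen_ord (leqnSn d) p.1, ord_max)].
  have h_inj : injective h.
    move=> [a t] [b u] /(congr1 val) /= /rcons_inj[tu ab].
    by congr (_, _); apply: val_inj.
  rewrite -(card_imset _ h_inj); apply: eq_card => t; rewrite !inE.
  apply/andP/imsetP => [[]|[[a u]]].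
    case: t => t /=; case/lastP: t => [|t q] //= szt.
    rewrite monotone_word_rcons M_rcons => /and3P[lt_q _ mt] /eqP q2.
    have q1 : q.1 < d by rewrite q2 in lt_q.
    have szt' : size t == m by rewrite size_rcons in szt.
    exists (Ordinal q1, Tuple szt'); first by rewrite inE.
    apply: val_inj => /=; congr rcons; rewrite -q2 [LHS]surjective_pairing.
    by congr (_, _); apply: val_inj.
  rewrite inE /= => mu ->; rewrite /= M_rcons monotone_word_rcons mu eqxx /= ltn_ord.
  by split=> //; rewrite andbT; apply/allP => r _; apply: leq_ord.
transitivity (count_words (fun t : seq ('I_d * 'I_d) => monotone_word t && true) m.+1);
  last by apply: eq_count_words => t _; rewrite andbT.
have wid_mono : {mono widen_ord (leqnSn d) : x y / x < y} by [].
rewrite -(count_words_relabel wid_mono (P := xpredT)) //.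
rewrite -[LHS]/(count_words (fun t => monotone_word t && ~~ M t) m.+1).
apply: eq_count_words => t szt; rewrite andbT; case/lastP: t szt => // t q _.
rewrite M_rcons monotone_word_rcons /word_on all_rcons !dE.
have -> : (q.2 == ord_max) = ~~ (q.2 < d).
  by rewrite -val_eqE /= -leqNgt eqn_leq leq_ord.
rewrite negbK; have [|//] := boolP [&& q.1 < q.2, all _ t & monotone_word t].
move=> /and3P[lt_q /allP le_q /andP[/allP lt_t _]].
have [qd|] := boolP (q.2 < d); last by rewrite /= andbF.
rewrite (ltn_trans lt_q qd) /=; apply/esym/allP => r rt.
by rewrite !dE (ltn_trans (lt_t r rt)) (leq_ltn_trans (le_q r rt) qd).
Qed.

(** * Transitivity and the number of cycles *)

(** A transposition stabilises a set exactly when its two points lie on the same side, so closed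
    sets are the sets stable under the group. Positivity of [N] supplies a point whose orbit is
    shown to be everything. *)
Lemma transitive_connected N (t : seq ('I_N * 'I_N)) : 0 < N ->
  [transitive <<[set x in transps t]>>%g, on [set: 'I_N] | 'P] = connected_on setT t.
Proof.
move=> N0; set G := <<_>>%g; pose x0 := Ordinal N0.
have closedE A : closed_under t A = (G \subset 'N(A | 'P))%g.
  rewrite gen_subG /=; apply/allP/subsetP => [tA s|tA q qt].
    rewrite inE => /mapP[q qt ->]; rewrite !inE; apply/subsetP => z.
    rewrite inE /= /aperm; case: tpermP => [->|->|//].
      by rewrite (eqP (tA q qt)).
    by rewrite (eqP (tA q qt)).
  have sP : tperm q.1 q.2 \in [set x in transps t] by rewrite inE; apply/mapP; exists q.
  have := astabs_act q.1 (tA _ sP); rewrite /= /aperm tpermL => ->; exact: eqxx.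
apply/idP/forallP => [trG A|conn].
  rewrite subsetT closedE; apply/implyP => actA.
  have [->|[x xA]] := set_0Vmem A; first by rewrite eqxx.
  apply/orP; right; rewrite -subTset -(atransP trG x (in_setT x)).
  by rewrite acts_sub_orbit.
apply/imsetP; exists x0; rewrite ?inE //; apply/esym/eqP.
have := conn (orbit 'P G x0); rewrite subsetT closedE.
have -> /= : (G \subset 'N(orbit 'P G x0 | 'P))%g.
  exact/acts_orbit/subsetT.
case/orP=> // /eqP o0; have := orbit_refl 'P G x0; by rewrite o0 inE.
Qed.

(* The values of [label t] stand for the orbits of the group generated by [t]. *)
Fixpoint label N (t : seq ('I_N * 'I_N)) : 'I_N -> 'I_N :=
  if t is q :: t' then
    fun z => if label t' z == label t' q.1 then label t' q.2 else label t' z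
  else id.

Lemma label_letter N (t : seq ('I_N * 'I_N)) q : q \in t -> label t q.1 = label t q.2.
Proof.
elim: t => // r t IHt; rewrite inE => /predU1P[->|/IHt] /=.
  by rewrite eqxx; case: eqP.
by move=> ->.
Qed.

(** Each transposition exchanges points with equal labels, so labels are constant along the cycles
    of the product. *)
Lemma label_compose N (t : seq ('I_N * 'I_N)) z :
  label t (compose_all (transps t) z) = label t z.
Proof.
elim: t z => [|q t IHt] z; first by rewrite /= perm1.
have lab_q : label (q :: t) q.1 = label (q :: t) q.2 by rewrite label_letter ?mem_head.
rewrite [compose_all _]/= permM.
transitivity (label (q :: t) (compose_all (transps t) z)).
  by case: tpermP => // ->.
by rewrite /= IHt.
Qed.

(** The level set of [label t] through [y] is closed and nonempty. *)
Lemma label_connected N (t : seq ('I_N * 'I_N)) x y :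
  connected_on setT t -> label t x = label t y.
Proof.
move=> /forallP/(_ [set z | label t z == label t y]); rewrite subsetT /=.
have -> /= : closed_under t [set z | label t z == label t y].
  by apply/allP => q qt; rewrite !inE (label_letter qt).
case/orP=> /eqP eA; last by have := in_setT x; rewrite -eA inE => /eqP.
by have := in_set0 y; rewrite -eA inE eqxx.
Qed.

(* Each letter lowers the number of label classes by at most one; it lowers the
   number of cycles when it merges two classes, and changes it by one otherwise. *)
Lemma porbits_label_bound N (t : seq ('I_N * 'I_N)) :
  #|porbits (compose_all (transps t))| + N <=
    size t + (#|[set label t z | z : 'I_N]|).*2.
Proof.
elim: t => [|q t IHt] /=.
  have -> : [set z | z : 'I_N] = setT by apply/setP => z; rewrite inE; apply/imsetP; exists z.
  rewrite cardsT card_ord add0n -addnn leq_add2r.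
  by rewrite -[leqRHS]card_ord; apply: leq_imset_card.
set s := compose_all _ in IHt *; set c := (X in _ <= _ + X.*2) in IHt.
set c' := (X in _ <= _ + X.*2).
(* [porbits_mul_tperm] multiplies on the left, but the transposition is the right factor here;
   inversion swaps the sides and keeps the cycles. *)
have := porbits_mul_tperm s^-1%g q.1 q.2.
rewrite /= -{1}(tpermV q.1 q.2) -invMg !porbitsV porbitV.
have [eq_lab|neq_lab] := eqVneq (label t q.1) (label t q.2).
  have -> : c' = c.
    congr #|pred_of_set _|; apply: eq_imset => z /=.
    by rewrite -eq_lab; case: eqP.
  move: (leq_b1 (q.1 != q.2)) IHt; move: (nat_of_bool (q.1 != q.2)) => b.
  rewrite /s; move: #|porbits (_ * _)%g| #|porbits _| => n' n.
  by clearbody c c'; lia.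
(* Different labels mean different cycles, which the transposition merges. *)
have -> : q.1 \notin porbit s q.2.
  apply: contraNN neq_lab => /porbitP[i ->]; rewrite eq_sym.
  elim: i => [|i /eqP->]; first by rewrite expg0 perm1.
  by rewrite expgSr permM label_compose.
(* Only the label of [q.1] can disappear. *)
have le_c : c <= c'.+1.
  rewrite -[c'.+1]add1n -(cards1 (label t q.1)); apply: leq_trans (leq_card_setU _ _).
  apply/subset_leq_card/subsetP => y /imsetP[z _ ->]; rewrite !inE.
  have [//|neq] := eqVneq (label t z) (label t q.1).
  by apply/imsetP; exists z; rewrite //= (negbTE neq).
move: (leq_b1 (q.1 != q.2)) IHt; move: (nat_of_bool (q.1 != q.2)) => b.
rewrite /s; move: #|porbits (_ * _)%g| #|porbits _| => n' n.
by clearbody c c'; lia.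
Qed.

(** A connected word has at most one label. This is the Riemann-Hurwitz inequality: the genus is
    nonnegative. *)
Lemma cycles_bound N (t : seq ('I_N * 'I_N)) : connected_on setT t ->
  #|porbits (compose_all (transps t))| + N <= size t + 2.
Proof.
move=> conn; apply: leq_trans (porbits_label_bound t) _.
rewrite leq_add2l -[2]/(1.*2) leq_double.
apply/card_le1P => x /imsetP[y _ ->] z.
apply/idP/eqP => [/imsetP[w _ ->]|->]; first exact: label_connected.
by apply/imsetP; exists y.
Qed.

(** The sign of the product, computed from its cycles and from its number of factors; this makes
    twice the genus even. *)
Lemma odd_cycles N (t : seq ('I_N * 'I_N)) :
  all (fun q : 'I_N * 'I_N => q.1 < q.2) t ->
  odd #|porbits (compose_all (transps t))| = odd (N + size t).
Proof.
move=> lt_t; have : odd_perm (compose_all (transps t)) = odd (size t).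
  elim: t lt_t => [|q t IHt] /= => [_|/andP[lt_q /IHt]]; first exact: odd_perm1.
  by rewrite odd_permM => ->; rewrite odd_tperm -val_eqE /= (ltn_eqF lt_q) addbT.
rewrite /odd_perm card_ord oddD; do 3!case: odd => //.
Qed.

(** * The exponent of the partition function *)

Definition num_cycles N (t : seq ('I_N * 'I_N)) := #|porbits (compose_all (transps t))|.

Definition cycle_count N m n :=
  count_words (fun t : seq ('I_N * 'I_N) =>
    [&& monotone_word t, connected_on setT t & num_cycles t == n]) m.

Lemma sum_card_porbits (T : finType) (s : {perm T}) :
  \sum_(A in porbits s) #|A| = #|T|.
Proof.
pose R x y := y \in porbit s x.
have R_equiv : {in [set: T] & &, equivalence_rel R}.
  move=> x y z _ _ _; rewrite /R porbit_id; split=> //.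
  by rewrite -eq_porbit_mem => /eqP->.
have <- : equivalence_partition R setT = porbits s.
  apply/setP => A; apply/imsetP/imsetP => -[x _ ->]; exists x => //;
    by apply/setP => y; rewrite !inE.
by rewrite -(card_partition (equivalence_partitionP R_equiv)) cardsT.
Qed.

Lemma num_cycles_gt0 N (t : seq ('I_N * 'I_N)) : 0 < N -> 0 < num_cycles t.
Proof.
move=> N0; apply/card_gt0P.
by exists (porbit (compose_all (transps t)) (Ordinal N0)); apply: imset_f.
Qed.

Lemma card_labellings (T : finType) n (A : {set T}) :
  #|[set f : {ffun 'I_n -> T} | injectiveb f && ([set f i | i : 'I_n] == A)]| =
  if #|A| == n then n`! else 0.
Proof.
case: eqP => [cA|/eqP cA].
  have := @card_inj_ffuns_on 'I_n T (mem A); rewrite card_ord cA ffactnn => <-.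
  apply: eq_card => f; rewrite !inE andbC; apply: andb_id2r => /injectiveP f_inj.
  have fE : #|[set f i | i : 'I_n]| = #|A| by rewrite card_imset // card_ord.
  rewrite eqEcard fE leqnn andbT.
  apply/subsetP/ffun_onP => [fA i|fA x /imsetP[i _ ->]]; last exact: fA.
  exact/fA/imset_f.
apply: eq_card0 => f; rewrite !inE; apply/negbTE; apply: contra cA.
by move=> /andP[/injectiveP f_inj /eqP <-]; rewrite card_imset // card_ord.
Qed.

(** A word with labelled cycles determines [mu], so the sum runs over all labelled words; each word
    with [n] cycles has n! labellings. *)
Lemma sum_monotone_count d m n : 0 < d ->
  \sum_(mu : {ffun 'I_n -> 'I_d.+1} |
          [forall i, 0 < mu i] && (\sum_(i < n) (mu i : nat) == d))
     monotone_count d m (fun i => mu i : nat) = cycle_count d m n * n`!.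
Proof.
move=> d0.
pose V (p : m.-tuple ('I_d * 'I_d) * {ffun 'I_n -> {set 'I_d}}) :=
  (monotone_word p.1 && connected_on setT p.1) &&
  (injectiveb p.2 && ([set p.2 i | i : 'I_n] == porbits (compose_all (transps p.1)))).
have validE mu p : monotone_valid mu p = V p && [forall i, #|p.2 i| == mu i].
  by rewrite /monotone_valid /V transitive_connected // /monotone_word -!andbA.
transitivity (\sum_(p | V p) 1).
  (* [mu] is read off as the vector of cycle lengths, each at most [d], so [inord] is faithful. *)
  rewrite (partition_big (fun p : m.-tuple ('I_d * 'I_d) * {ffun 'I_n -> {set 'I_d}} =>
       [ffun i => inord #|p.2 i|] : {ffun 'I_n -> 'I_d.+1})
     (fun mu => [forall i, 0 < mu i] && (\sum_(i < n) (mu i : nat) == d))) /=.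
    apply: eq_bigr => mu _; rewrite sum1_card /monotone_count.
    apply: eq_card => p; rewrite !inE [RHS]/in_mem /= validE; congr (_ && _).
    apply/forallP/eqP => [pmu|<- i].
      by apply/ffunP => i; rewrite ffunE (eqP (pmu i)) inord_val.
    by rewrite ffunE inordK // ltnS -[leqRHS]card_ord max_card.
  move=> [t f] /andP[_ /andP[/= /injectiveP f_inj /eqP imf]].
  have fE i : ([ffun i => inord #|f i|] : {ffun 'I_n -> 'I_d.+1}) i = #|f i| :> nat.
    by rewrite ffunE inordK // ltnS -[leqRHS]card_ord max_card.
  apply/andP; split.
    apply/forallP => i; rewrite fE.
    have : f i \in porbits (compose_all (transps t)) by rewrite -imf imset_f.
    by case/imsetP => x _ ->; apply/card_gt0P; exists x; apply: porbit_id.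
  under eq_bigr => i _ do rewrite fE.
  rewrite -[X in _ == X](card_ord d) -(sum_card_porbits (compose_all (transps t))) -imf.
  by rewrite big_imset //= => i j _ _; apply: f_inj.
rewrite /cycle_count /count_words -sum_nat_const.
rewrite (eq_bigl (fun p : m.-tuple ('I_d * 'I_d) * {ffun 'I_n -> {set 'I_d}} =>
   (monotone_word p.1 && connected_on setT p.1) &&
   (injectiveb p.2 && ([set p.2 i | i : 'I_n] == porbits (compose_all (transps p.1)))))) //.
rewrite -(pair_big_dep
   (fun t : m.-tuple ('I_d * 'I_d) => monotone_word t && connected_on setT t)
   (fun t (f : {ffun 'I_n -> {set 'I_d}}) =>
      injectiveb f && ([set f i | i : 'I_n] == porbits (compose_all (transps t))))
   (fun _ _ => 1)) /=.
rewrite [RHS](eq_bigl (fun t : m.-tuple ('I_d * 'I_d) =>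
   (monotone_word t && connected_on setT t) && (num_cycles t == n))); last first.
  by move=> t; rewrite inE andbA.
rewrite [RHS]big_mkcondr; apply: eq_bigr => t _.
by rewrite -card_labellings sum1dep_card.
Qed.
Local Open Scope ring_scope.

(** The second hypothesis is m = 2g - 2 + n + d without subtraction; it excludes the zero branch of
    [monotoneH]. *)
Lemma Fdiag_coefE g n d m : (0 < d)%N -> (2 * g + n + d = m.+2)%N ->
  Fdiag_coef g n d = (n`!)%:R * (cycle_count d m n)%:R / (d`!)%:R.
Proof.
move=> d0 gE; rewrite -natrM [(n`! * _)%N]mulnC -sum_monotone_count // natr_sum mulr_suml.
apply: eq_bigr => mu /andP[_ /eqP muE].
rewrite /monotoneH muE.
by rewrite gE subn2.
Qed.

(** [K] is left free so that it can match the summation range in [logZ]. *)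
Lemma conn_count_cycles d m K :
  (forall t : seq ('I_d * 'I_d), size t = m -> connected_on setT t -> (num_cycles t <= K)%N) ->
  conn_count d m = (\sum_(n < K.+1) cycle_count d m n)%N.
Proof.
move=> bnd; rewrite /conn_count /count_words -sum1dep_card.
rewrite (partition_big
  (fun t : m.-tuple ('I_d * 'I_d) => inord (num_cycles t) : 'I_K.+1) xpredT) //.
apply: eq_bigr => n _; rewrite /cycle_count /count_words -sum1dep_card.
apply: eq_bigl => t; rewrite -andbA; apply: andb_id2l => _; apply: andb_id2l => conn.
by rewrite -val_eqE /= inordK // ltnS bnd ?size_tuple.
Qed.

Lemma logZ0 k : logZ 0 k = 0.
Proof.
apply: big1 => n _; apply: big1 => g _; case: ifP => // /andP[n0 _].
rewrite (_ : Fdiag_coef g n 0 = 0) ?mul0r //.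
apply: big_pred0 => mu; apply/negbTE; apply/negP => /andP[/forallP/(_ (Ordinal n0))].
by case: (mu _) => -[].
Qed.

Lemma euler_exponentE g n d m :
  ((2 * g + n)%:Z - 2 == m%:Z - d%:Z) = (2 * g + n + d == m.+2)%N.
Proof. by apply/eqP/eqP; lia. Qed.

Lemma leq_exponent c d m :
  (c + d <= m + 2)%N -> (c <= absz (m%:Z - d%:Z + 2)%R)%N.
Proof. by lia. Qed.

(** Twice the genus is m + 2 - d - n, even by the parity hypothesis; the last bound puts the genus
    in the range summed in [logZ]. *)
Lemma genus_exists n d m : odd n = odd (d + m) -> (n + d <= m + 2)%N ->
  exists2 g, (2 * g + n + d = m.+2)%N & (g <= absz (m%:Z - d%:Z + 2)%R)%N.
Proof.
move=> odd_n le_n; have even_g : odd (m + 2 - d - n) = false.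
  by rewrite !oddB ?oddD ?odd_n; lia.
by exists (m + 2 - d - n)./2; lia.
Qed.

Lemma genus_unique g g' n d m :
  (2 * g + n + d = m.+2)%N -> (2 * g' + n + d = m.+2)%N -> g = g'.
Proof. by lia. Qed.

Lemma logZE d m : (0 < d)%N -> logZ d (m%:Z - d%:Z) = (conn_count d m)%:R / (d`!)%:R.
Proof.
move=> d0; rewrite /logZ; have := fun n => @genus_exists n d m.
have := fun c => @leq_exponent c d m.
move: (absz _) => K le_K genusK.
have KE t : size t = m -> connected_on [set: 'I_d] t -> (num_cycles t <= K)%N.
  by move=> szt /cycles_bound; rewrite szt => /le_K.
rewrite (conn_count_cycles KE) natr_sum mulr_suml; apply: eq_bigr => n _.
have termE g : (2 * g + n + d = m.+2)%N ->
    Fdiag_coef g n d / (n`!)%:R = (cycle_count d m n)%:R / (d`!)%:R.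
  move=> gE; rewrite (Fdiag_coefE d0 gE) [LHS]mulrAC [(n`!)%:R * _]mulrC.
  by rewrite mulfK // pnatr_eq0 -lt0n fact_gt0.
under eq_bigr => g _ do rewrite euler_exponentE.
(* If no word has [n] cycles, every genus term vanishes. Otherwise a witness word supplies the
   parity and the bound that yield the one contributing genus. *)
have [c0|c_pos] := posnP (cycle_count d m n).
  rewrite c0 mul0r; apply: big1 => g _; case: ifP => // /andP[_ /eqP gE].
  by rewrite termE // c0 mul0r.
have [t] : exists t : m.-tuple _, t \in [set t : m.-tuple ('I_d * 'I_d) |
    [&& monotone_word t, connected_on setT t & num_cycles t == n]].
  exact/card_gt0P.
rewrite inE => /and3P[/andP[lt_t _] conn /eqP tn].
have n0 : (0 < n)%N by rewrite -tn num_cycles_gt0.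
have := cycles_bound conn; have := odd_cycles lt_t; rewrite -/(num_cycles t) tn size_tuple.
move=> odd_n le_n; have [g gE gK] := genusK n odd_n le_n.
rewrite -ltnS in gK; rewrite (bigD1 (Ordinal gK)) //= big1 ?addr0 => [|g' neq].
  by rewrite n0 gE eqxx /= termE.
rewrite ifF //; apply: contraNF neq => /andP[_ /eqP g'E].
exact/eqP/val_inj/(genus_unique g'E gE).
Qed.

(** * The exponential and the quantum curve *)

(* [agree D M s p]: up to degree [D] in x / hbar and [M] in hbar, the series [s]
   has the coefficients of the polynomial [p]. *)
Definition agree (D M : nat) (s : series) (p : {poly {poly rat}}) :=
  forall i j : nat, (i <= D)%N -> (j <= M)%N -> p`_i`_j = s i (j%:Z - i%:Z).

Lemma agree_one D M : agree D M oneS 1.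
Proof.
move=> i j _ _; rewrite coef1 /oneS; case: i => [|i] /=; last by rewrite coef0.
by rewrite subr0 coef1; case: j.
Qed.

(** In the variables x / hbar and hbar, [mulS] is the Cauchy product, and a coefficient involves
    only lower degrees. *)
Lemma agree_mul D M s t p q :
  agree D M s p -> agree D M t q -> agree D M (mulS s t) (p * q).
Proof.
move=> sp tq i j iD jM; rewrite /mulS ifF; last by apply/negbTE; lia.
have -> : absz (j%:Z - i%:Z + i%:Z) = j by lia.
rewrite coefM coef_sum; apply: eq_bigr => d _; rewrite coefM; apply: eq_bigr => a _.
have := ltn_ord d; have := ltn_ord a => aj di.
rewrite sp ?tq; try lia.
by congr (_ * t _ _); lia.
Qed.

Lemma agree_pow D M s p n : agree D M s p -> agree D M (powS s n) (p ^+ n).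
Proof.
move=> sp; elim: n => [|n IHn]; first exact: agree_one.
by rewrite exprS; apply: agree_mul.
Qed.

Lemma coef_exp_lt (R : nzRingType) (p : {poly R}) n i :
  p`_0 = 0 -> (i < n)%N -> (p ^+ n)`_i = 0.
Proof.
move=> p0; elim: n i => // n IHn i lt_i; rewrite exprS coefM; apply: big1 => d _.
case: d => -[|d] /= lt_d; first by rewrite p0 mul0r.
by rewrite IHn ?mulr0 //; lia.
Qed.

Lemma expS_neg s d k : k + d%:Z < 0 -> expS s d k = 0.
Proof.
move=> kd; apply: big1 => -[j _] _ /=.
rewrite (_ : powS s j d k = 0) ?mul0r //; case: j => [|j] /=; last by rewrite /mulS kd.
by rewrite /oneS ifF //; apply/negbTE; lia.
Qed.

Definition exp_poly (p : {poly {poly rat}}) D :=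
  \sum_(j < D.+1) ((j`!)%:R^-1)%:P *: p ^+ j.

(** A power p^n has no terms of degree below n in x / hbar, so the truncation orders of [expS] and
    [exp_poly] both reduce to [i]. *)
Lemma agree_exp D M s (p : {poly {poly rat}}) : p`_0 = 0 -> agree D M s p ->
  agree D M (expS s) (exp_poly p D).
Proof.
move=> p0 sp i j iD jM.
have -> : expS s i (j%:Z - i%:Z) = \sum_(n < (i + j).+1) (p ^+ n)`_i`_j / (n`!)%:R.
  rewrite /expS (_ : absz _ = (i + j)%N); last by lia.
  by apply: eq_bigr => n _; rewrite (agree_pow n sp).
have trunc B : (i <= B)%N ->
    \sum_(n < B.+1) (p ^+ n)`_i`_j / (n`!)%:R = \sum_(n < i.+1) (p ^+ n)`_i`_j / (n`!)%:R.
  move=> iB; rewrite [RHS](big_ord_widen B.+1 (fun n => (p ^+ n)`_i`_j / (n`!)%:R)) ?ltnS //.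
  rewrite [RHS]big_mkcond; apply: eq_bigr => n _; case: ifP => // /negbT.
  rewrite -leqNgt => lt_i.
  by rewrite coef_exp_lt // coef0 mul0r.
rewrite (trunc (i + j)%N) ?leq_addr // -(trunc D) // /exp_poly !coef_sum.
by apply: eq_bigr => n _; rewrite coefZ coefCM mulrC.
Qed.

(** The rule (exp p)' = p' exp p holds exactly for truncations when the order drops by one. *)
Lemma deriv_exp_poly p D :
  (exp_poly p D.+1)^`() = exp_poly p D * p^`().
Proof.
rewrite /exp_poly raddf_sum big_ord_recl /= expr0 linearZ /= derivC scaler0 add0r.
rewrite mulr_suml; apply: eq_bigr => j _.
rewrite [bump 0 j]add1n derivZ deriv_exp -scalerMnr scalerMnl -polyCMn -scalerAl mulrC.
congr (_%:P *: _); rewrite -[LHS]mulr_natl factS natrM invfM mulrA mulfV ?mul1r //.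
by rewrite pnatr_eq0.
Qed.

(** The coefficient form of (exp s)' = s' exp s, transferred from polynomials that truncate [s]. *)
Lemma expS_rec s d m : (forall k, s 0%N k = 0) ->
  d.+1%:R * expS s d.+1 (m%:Z - d.+1%:Z) =
  \sum_(i < d.+1) \sum_(a < m.+1)
     i.+1%:R * s i.+1 (a%:Z - i.+1%:Z) * expS s (d - i)%N ((m - a)%N%:Z - (d - i)%N%:Z).
Proof.
move=> s0.
pose p : {poly {poly rat}} := \poly_(i < d.+2) \poly_(j < m.+1) s i (j%:Z - i%:Z).
have sp : agree d.+1 m s p by move=> i j iD jM; rewrite coef_poly ltnS iD coef_poly ltnS jM.
have p0 : p`_0 = 0.
  by apply/polyP => j; rewrite coef0 coef_poly /= coef_poly s0 if_same.
(* The derivative lowers the truncation order of the exponential factor to [d]. *)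
have spd : agree d m s p by move=> i j iD; apply: sp; apply: leqW.
have eE := agree_exp p0 sp; have eEd := agree_exp p0 spd.
have := congr1 (fun q : {poly {poly rat}} => q`_d`_m) (deriv_exp_poly p d).
rewrite /= coef_deriv coefMn eE // mulr_natl => ->.
rewrite coefMr coef_sum; apply: eq_bigr => i _.
rewrite coefMr; apply: eq_bigr => a _.
have := ltn_ord i; have := ltn_ord a => aj di.
rewrite eEd; try lia.
rewrite coef_deriv coefMn sp; try lia.
by rewrite [RHS]mulrC mulr_natl.
Qed.

Lemma expS0 s m : (forall k, s 0%N k = 0) -> expS s 0 m%:Z = (m == 0%N)%:R.
Proof.
move=> s0; pose p : {poly {poly rat}} := 0.
have sp : agree 0 m s p by move=> i j; rewrite leqn0 => /eqP-> _; rewrite !coef0 s0.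
have := agree_exp (coef0 _ 0) sp (leqnn 0) (leqnn m); rewrite subr0 => <-.
rewrite /exp_poly big_ord1 expr0 fact0 invr1 scale1r.
by rewrite coef1 /= coef1.
Qed.

(** The block recursion divided by (d+1)!, brought to the shape of [expS_rec]; the factor [j] kills
    the empty block. *)
Lemma mono_count_rec d m :
  d.+1%:R * ((mono_count d.+1 m)%:R / (d.+1`!)%:R) =
  \sum_(i < d.+1) \sum_(a < m.+1)
     i.+1%:R * ((conn_count i.+1 a)%:R / (i.+1`!)%:R) *
     ((mono_count (d - i) (m - a))%:R / ((d - i)`!)%:R) :> rat.
Proof.
rewrite mulrA -natrM mono_count_blocks big_ord_recl /= mul0n muln0 add0n.
rewrite natr_sum mulr_suml; apply: eq_bigr => i _; rewrite [bump 0 i]add1n.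
rewrite (natrM _ 'C(_, _)) (natrM _ i.+1) natr_sum mulrA mulr_sumr mulr_suml.
apply: eq_bigr => a _; rewrite (natrM _ (conn_count _ _)).
have -> : (d.+1`!)%:R = 'C(d.+1, i.+1)%:R * ((i.+1`!)%:R * ((d - i)`!)%:R) :> rat.
  by rewrite -!natrM -subSS bin_fact.
have f0 n : (n`!)%:R != 0 :> rat by rewrite pnatr_eq0 -lt0n fact_gt0.
have b0 : ('C(d.+1, i.+1))%:R != 0 :> rat by rewrite pnatr_eq0 -lt0n bin_gt0.
move: (f0 i.+1) (f0 (d - i)%N) b0.
move: (i.+1`!)%:R ((d - i)`!)%:R 'C(_, _)%:R => x y z x0 y0 z0.
move: (conn_count _ _)%:R (mono_count _ _)%:R i.+1%:R => u v w.
by field; rewrite x0 y0 z0.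
Qed.

(** Both sides satisfy the same recursion in [d] and agree at d = 0, where only the empty word
    exists. *)
Lemma ZserE d m : Zser d (m%:Z - d%:Z) = (mono_count d m)%:R / (d`!)%:R.
Proof.
elim/ltn_ind: d m => -[|d] IHd m.
  rewrite subr0 /Zser expS0; last exact: logZ0.
  by case: m => [|m]; rewrite ?mono_count0 ?mono_count_ord0 ?fact0 ?invr1 ?mul0r.
have d0 : d.+1%:R != 0 :> rat by rewrite pnatr_eq0.
apply: (mulfI d0); rewrite mono_count_rec /Zser expS_rec; last exact: logZ0.
apply: eq_bigr => i _; apply: eq_bigr => a _.
by rewrite logZE // -/Zser IHd //; rewrite ltnS leq_subr.
Qed.

Theorem theorem2 :
  in_Qxh Zser /\
  (forall (d : nat) (k : int), quantum_curve_op Zser d k = 0).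
Proof.
have Zneg d k : k + d%:Z < 0 -> Zser d k = 0 by exact: expS_neg.
split=> [|d k]; first exact: Zneg.
rewrite /quantum_curve_op /addS /subS /mulxS /mulhS /dxS.
have [kd|kd] := ltP (k + d%:Z) 0.
  by case: d kd => [|d] kd; rewrite !Zneg ?mulr0 ?subrr ?addr0 //; lia.
have [m mE] : exists m : nat, k = m%:Z - d%:Z by exists (absz (k + d%:Z)); lia.
have f0 n : (n`!)%:R != 0 :> rat by rewrite pnatr_eq0 -lt0n fact_gt0.
(* hbar d/dx raises the x-index and lowers the hbar-index by one, so the word length [m] is
   unchanged. *)
have Z1 : Zser d.+1 (k - 1) = (mono_count d.+1 m)%:R / (d.+1`!)%:R.
  by rewrite -ZserE; congr Zser; lia.
rewrite Z1 mE ZserE.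
(* At d = 0 the second-order term is absent, and the equation says D(1,m) = D(0,m). *)
case: d mE {kd Z1} => [|d] mE.
  rewrite /= fact0 (_ : 1`! = 1%N) //.
  case: m mE => [|m] mE; first by rewrite !mono_count0 invr1 !mul1r sub0r addNr.
  by rewrite mono_countSS mul0n add0n invr1 mulr1 mul1r sub0r addNr.
have fE : (d.+2`!)%:R = d.+2%:R * (d.+1`!)%:R :> rat by rewrite factS (natrM _ d.+2).
have := f0 d.+1; have : d.+2%:R != 0 :> rat by rewrite pnatr_eq0.
rewrite fE; case: m mE => [|m] mE.
  (* For m = 0 the second-order term would need a word of length -1. *)
  rewrite Zneg; last by lia.
  rewrite !mono_count0; move: d.+2%:R (d.+1`!)%:R d.+1%:R => x y z x0 y0.
  by field; rewrite x0 y0.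
(* The second-order term has word length one less; the identity is now [mono_countSS] divided by
   (d+1)!. *)
have -> : m.+1%:Z - d.+1%:Z - 1 - 1 = m%:Z - d.+2%:Z by lia.
rewrite ZserE fE mono_countSS natrD (natrM _ d.+1).
move: d.+2%:R (d.+1`!)%:R d.+1%:R => x y z x0 y0.
move: ((mono_count d.+2 m)%:R : rat) ((mono_count d.+1 m.+1)%:R : rat) => u v.
by field; rewrite x0 y0.
Qed.
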